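(* Let $G$ be a graph, let $t\geq 0$ be an integer, and let $H$ be the $t$-core of $G$. If $\operatorname{cfan}(H)\leq t$, then $\operatorname{Fan}(G)\leq \Delta(G)+t$.
   Context: A graph may have parallel edges but no loops. For a graph $J$ and vertices $x,y$, $\mu_J(x,y)$ is the number of edges of $J$ joining $x,y$; $\mu_J(v)=\max_u\mu_J(v,u)$; $d_J(v)$ is the degree of $v$ in $J$ counting parallel edges; $N_J(x)$ is the set of neighbours of $x$ in $J$; $\Delta(G)$ is the maximum degree. A subgraph may contain only some of the parallel copies of an edge. The $t$-core of $G$ is the subgraph of $G$ induced by the vertices $v$ with $d_G(v)+\mu_G(v)>\Delta(G)+t$. Fan number: for $J\subseteq G$ and $xy\in E(J)$, the fan-degree $\deg_J(x,y)$ is the smallest nonnegative integer $k$ such that either (i) $d_J(x)+d_J(y)-\mu_J(x,y)\leq k$, or (ii) $\sum_{z\in Z}(d_J(z)+\mu_J(x,z)-k)\leq 1$ for all $Z\subseteq N_J(x)$ with $y\in Z$ and $|Z|\geq 2$. Then $\operatorname{fan}(G)=\max_{J\subseteq G,\,E(J)\neq\emptyset}\min\{\deg_J(x,y): xy\in E(J)\}$ (and $\operatorname{fan}(G)=0$ if $G$ is edgeless), and $\operatorname{Fan}(G)=\max\{\Delta(G),\operatorname{fan}(G)\}$. Cfan number: for a graph $H$, a subgraph $K\subseteq H$ and an ordered pair $(x,y)$ with $xy\in E(K)$, $\operatorname{cdeg}_{H,K}(x,y)$ is the smallest nonnegative integer $l$ such that for all $Z\subseteq N_K(x)$ with $y\in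 Z$ (no restriction on $|Z|$), $\sum_{z\in Z}(d_K(z)-d_H(z)+\mu_K(x,z)-l)\leq 1$. Then $\operatorname{cfan}(H)=\max_{K\subseteq H,\,E(K)\neq\emptyset}\min\{\operatorname{cdeg}_{H,K}(x,y): xy\in E(K)\}$, with $\operatorname{cfan}(H)=0$ if $H$ is edgeless. *)

(* Defs.v *)
From HB Require Import structures.
From mathcomp Require Import all_boot all_order all_algebra.

Set Implicit Arguments.
Unset Strict Implicit.
Unset Printing Implicit Defensive.

Import Order.TTheory GRing.Theory Num.Theory.

(* Finite graphs with parallel edges and without loops: an edge is incident   *)
(* with exactly two distinct vertices.                                        *)
Record mgraph := MGraph {
  vertex : finType;
  edge : finType;
  ends : edge -> {set vertex};
  card_ends : forall e, #|ends e| = 2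
}.

(* A subgraph of G is a pair (vertices, edges) closed under taking ends; it   *)
(* may keep only some of the parallel edges joining two vertices. All graph   *)
(* parameters are defined for subgraphs, G itself being [whole G], so that    *)
(* the nested subgraphs of G live in one finite type.                         *)
Record subgraph (G : mgraph) := Subgraph {
  sgval : {set vertex G} * {set edge G};
  _ : [forall e in sgval.2, ends e \subset sgval.1]
}.

HB.instance Definition _ (G : mgraph) := [isSub for @sgval G].
HB.instance Definition _ (G : mgraph) := [Finite of subgraph G by <:].

Definition verts (G : mgraph) (J : subgraph G) : {set vertex G} := (sgval J).1.
Definition edges (G : mgraph) (J : subgraph G) : {set edge G} := (sgval J).2.

Definition is_subgraph (G : mgraph) (J K : subgraph G) : bool :=
  (verts J \subset verts K) && (edges J \subset edges K).

Lemma induced_proof (G : mgraph) (S : {set vertex G}) :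
  [forall e in [set e : edge G | ends e \subset S], ends e \subset S].
Proof. by apply/forall_inP => e; rewrite inE. Qed.

Definition induced (G : mgraph) (S : {set vertex G}) : subgraph G :=
  @Subgraph G (S, [set e : edge G | ends e \subset S]) (induced_proof S).

Definition whole (G : mgraph) : subgraph G := induced [set: vertex G].

Lemma verts_whole (G : mgraph) : verts (whole G) = [set: vertex G].
Proof. by []. Qed.

Lemma edges_whole (G : mgraph) : edges (whole G) = [set: edge G].
Proof. by apply/setP => e; rewrite !inE subsetT. Qed.

Definition mu (G : mgraph) (J : subgraph G) (x y : vertex G) : nat :=
  #|[set e in edges J | ends e == [set x; y]]|.
Definition mu_max (G : mgraph) (J : subgraph G) (v : vertex G) : nat :=
  \max_(u in verts J) mu J v u.
Definition degree (G : mgraph) (J : subgraph G) (v : vertex G) : nat :=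
  #|[set e in edges J | v \in ends e]|.
Definition nbr (G : mgraph) (J : subgraph G) (x : vertex G) : {set vertex G} :=
  [set z | 0 < mu J x z].
Definition Delta (G : mgraph) (J : subgraph G) : nat :=
  \max_(v in verts J) degree J v.

(* The ordered pairs (x, y) with xy an edge of J; each edge contributes both  *)
(* orientations.                                                              *)
Definition arcs (G : mgraph) (J : subgraph G) : {set vertex G * vertex G} :=
  [set p | p.2 \in nbr J p.1].

Definition core (G : mgraph) (t : nat) : subgraph G :=
  induced [set v | Delta (whole G) + t
                   < degree (whole G) v + mu_max (whole G) v].

(* Minimum of a nonempty list (0 on the empty list). *)
Definition min_seq (s : seq nat) : nat := \big[minn/head 0 s]_(k <- s) k.

Lemma min_seq_le (s : seq nat) k : k \in s -> min_seq s <= k.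
Proof.
rewrite /min_seq; elim: s (head 0 s) => // a s IHs b.
rewrite inE big_cons => /orP[/eqP -> | /IHs sk]; first exact: geq_minl.
exact: leq_trans (geq_minr _ _) (sk b).
Qed.

Lemma min_seq_in (s : seq nat) : s != [::] -> min_seq s \in s.
Proof.
case: s => // a s _; rewrite /min_seq /= big_seq.
apply: (big_ind (fun k => k \in a :: s)) => [|k l ks ls|//].
  by rewrite inE eqxx.
by rewrite /minn; case: ifP.
Qed.

Definition deg_cond (G : mgraph) (J : subgraph G) (x y : vertex G) (k : nat)
  : bool :=
  ((degree J x)%:Z + (degree J y)%:Z - (mu J x y)%:Z <= k%:Z)%R
  || [forall Z : {set vertex G},
       [&& Z \subset nbr J x, y \in Z & 2 <= #|Z|] ==>
       (\sum_(z in Z) ((degree J z)%:Z + (mu J x z)%:Z - k%:Z) <= 1)%R].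

Lemma deg_cond_ex (G : mgraph) (J : subgraph G) (x y : vertex G)
  : exists k, deg_cond J x y k.
Proof.
exists (degree J x + degree J y); apply/orP; left.
by rewrite PoszD lerBlDr lerDl.
Qed.

Definition deg (G : mgraph) (J : subgraph G) (x y : vertex G) : nat :=
  ex_minn (deg_cond_ex J x y).

(* With edges J != set0 the inner minimum ranges over a nonempty list,        *)
(* and the empty maximum is 0 when the graph has no edges.                    *)
Definition fan (G : mgraph) (H : subgraph G) : nat :=
  \max_(J : subgraph G | is_subgraph J H && (edges J != set0))
    min_seq [seq deg J p.1 p.2 | p in arcs J].

Definition Fan (G : mgraph) (H : subgraph G) : nat := maxn (Delta H) (fan H).

Definition cdeg_cond (G : mgraph) (H K : subgraph G) (x y : vertex G) (l : nat)
  : bool :=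
  [forall Z : {set vertex G},
    (Z \subset nbr K x) && (y \in Z) ==>
    (\sum_(z in Z) ((degree K z)%:Z - (degree H z)%:Z + (mu K x z)%:Z - l%:Z)
       <= 1)%R].

Lemma cdeg_cond_ex (G : mgraph) (H K : subgraph G) (x y : vertex G)
  : exists l, cdeg_cond H K x y l.
Proof.
exists (\max_z (degree K z + mu K x z)).
apply/forallP => Z; apply/implyP => _.
apply: (@le_trans _ _ 0%R) => //; apply: sumr_le0 => z _.
rewrite subr_le0 addrAC lerBlDr -PoszD; apply: ler_wpDr => //.
by rewrite lez_nat (leq_bigmax (F := fun z => degree K z + mu K x z)).
Qed.

Definition cdeg (G : mgraph) (H K : subgraph G) (x y : vertex G) : nat :=
  ex_minn (cdeg_cond_ex H K x y).

Definition cfan (G : mgraph) (H : subgraph G) : nat :=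
  \max_(K : subgraph G | is_subgraph K H && (edges K != set0))
    min_seq [seq cdeg H K p.1 p.2 | p in arcs K].

Lemma arcs_neq0 (G : mgraph) (J : subgraph G)
  : edges J != set0 -> arcs J != set0.
Proof.
case/set0Pn => e Je; have /eqP/cards2P[x [y [_ De]]] := card_ends e.
apply/set0Pn; exists (x, y); rewrite !inE /= /mu card_gt0.
by apply/set0Pn; exists e; rewrite inE Je De eqxx.
Qed.

(* Main.v *)
(** Write [k = Delta G + t], let [H] be the [t]-core of [G] and let [J] be a
    subgraph of [G] with an edge. A vertex [z] outside [H] contributes at most
    [0] to the sums in the definition of [deg_J(x, y) <= k], and for [z] in [H]
    we have [d_J(z) - Delta G <= d_J(z) - d_G(z) <= d_K(z) - d_H(z)], where [K]
    is the intersection of [J] and [H]. Hence an arc [xy] of [K] with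
    [cdeg_{H,K}(x, y) <= t] also satisfies [deg_J(x, y) <= k]. If [K] is
    edgeless, [J] has an arc [xy] such that no neighbour of [x] lies in [H], and
    then the sums for [xy] are nonpositive. *)
Require Import Defs.
From mathcomp Require Import all_boot.
From mathcomp Require Import all_order all_algebra.
From mathcomp Require Import zify.

Set Implicit Arguments.
Unset Strict Implicit.
Unset Printing Implicit Defensive.

Import Order.TTheory GRing.Theory Num.Theory.

Section Subgraphs.

Variable G : mgraph.
Implicit Types (J K H : subgraph G) (x y z : vertex G) (S : {set vertex G}).

Lemma meet_proof J K :
  [forall e in edges J :&: edges K, ends e \subset verts J :&: verts K].
Proof.
apply/forall_inP => e /setIP[Je Ke]; rewrite subsetI.
have /forall_inP/(_ e Je) -> := valP J.
by have /forall_inP/(_ e Ke) -> := valP K.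
Qed.

Definition meet J K : subgraph G :=
  @Subgraph G (verts J :&: verts K, edges J :&: edges K) (meet_proof J K).

Lemma meet_subr J K : is_subgraph (meet J K) K.
Proof. by rewrite /is_subgraph !subsetIr. Qed.

Lemma muC J x y : mu J x y = mu J y x.
Proof. by rewrite /mu setUC. Qed.

Lemma mu_sub J K x y : edges J \subset edges K -> mu J x y <= mu K x y.
Proof. by move=> sJK; apply/subset_leq_card; rewrite !setIdE setSI. Qed.

Lemma degree_sub J K x : edges J \subset edges K -> degree J x <= degree K x.
Proof. by move=> sJK; apply/subset_leq_card; rewrite !setIdE setSI. Qed.

Lemma sub_whole J : is_subgraph J (whole G).
Proof. by rewrite /is_subgraph edges_whole !subsetT. Qed.

Lemma degree_Delta x : degree (whole G) x <= Delta (whole G).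
Proof. by apply: leq_bigmax_cond; rewrite verts_whole. Qed.

Lemma mu_le_mu_max x y : mu (whole G) x y <= mu_max (whole G) x.
Proof. by apply: leq_bigmax_cond; rewrite verts_whole. Qed.

(** Inclusion-exclusion for the edges at [x]: those common to [J] and [H] are the edges of the meet,
    and the union lies in [G]. Rearranged, it compares the degree lost from [G] to [J] with that
    lost from [H] to the meet. *)
Lemma degree_meet J H x :
  degree J x + degree H x <= degree (meet J H) x + degree (whole G) x.
Proof.
rewrite /degree -cardsUI addnC leq_add //; apply/subset_leq_card/subsetP => e.
  by rewrite !inE => /andP[/andP[-> ->] /andP[-> _]].
by rewrite edges_whole !inE => /orP[] /andP[].
Qed.

(** An induced subgraph keeps every parallel copy of an edge between two of its vertices. *)
Lemma mu_meet_induced J S x y :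
  x \in S -> y \in S -> mu (meet J (induced S)) x y = mu J x y.
Proof.
move=> Sx Sy; apply: eq_card => e; rewrite !inE -andbA; congr (_ && _).
by case: eqP => [->|]; rewrite ?andbF // subUset !sub1set Sx Sy.
Qed.

Lemma arcsC J x y : ((x, y) \in arcs J) = ((y, x) \in arcs J).
Proof. by rewrite !inE /= muC. Qed.

Lemma fan_leq H k :
  (forall J, is_subgraph J H -> edges J != set0 ->
     exists2 p, p \in arcs J & deg_cond J p.1 p.2 k) ->
  fan H <= k.
Proof.
move=> degP; apply/bigmax_leqP => J /andP[sJH /(degP J sJH)[p Jp kp]].
have deg_k : deg J p.1 p.2 <= k by rewrite /deg; case: ex_minnP => m _; apply.
apply: leq_trans deg_k; apply: min_seq_le.
exact: (image_f (fun p => deg J p.1 p.2)).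
Qed.

(** A bound on [cfan] gives the condition only at the minimum [cdeg]; this carries it up to the
    bound itself. *)
Lemma cdeg_cond_mono H K x y l m :
  l <= m -> cdeg_cond H K x y l -> cdeg_cond H K x y m.
Proof.
move=> lm /forallP lP; apply/forallP => Z; apply/implyP => sZ.
by apply: le_trans (implyP (lP Z) sZ); apply: ler_sum => z _; lia.
Qed.

Lemma cfan_leq H K l :
  cfan H <= l -> is_subgraph K H -> edges K != set0 ->
  exists2 p, p \in arcs K & cdeg_cond H K p.1 p.2 l.
Proof.
move=> Hl sKH K0; set s := [seq cdeg H K p.1 p.2 | p in arcs K].
have s_l : min_seq s <= l.
  by move/bigmax_leqP: Hl => /(_ K); rewrite sKH K0; apply.
(* [min_seq] defaults to 0 on the empty list, so an arc is needed for the minimum to be attained. *)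
have s0 : s != [::].
  by rewrite -size_eq0 size_image cards_eq0 arcs_neq0.
have /imageP[p Kp Dp] := min_seq_in s0.
exists p => //; move: s_l; rewrite Dp /cdeg; case: ex_minnP => m mP _ ml.
exact: cdeg_cond_mono ml mP.
Qed.

(** Outside the core, the degree of [z] plus its maximum multiplicity in [G] is at most
    [Delta (whole G) + t], and passing to [J] only decreases both. *)
Lemma fan_term_le0 J t x z : z \notin verts (core G t) ->
  ((degree J z)%:Z + (mu J x z)%:Z - (Delta (whole G) + t)%:Z <= 0)%R.
Proof.
rewrite inE -leqNgt => core'z.
have /andP[_ sJG] := sub_whole J.
have := degree_sub z sJG; have := mu_sub z x sJG; rewrite [mu J z x]muC.
by have := mu_le_mu_max z x; lia.
Qed.

Lemma deg_cond_core_free J t x y :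
    [disjoint nbr J x & verts (core G t)] ->
  deg_cond J x y (Delta (whole G) + t).
Proof.
move=> coreN; apply/orP; right; apply/forallP => Z.
apply/implyP => /and3P[sZN _ _]; apply: (@le_trans _ _ 0%R) => //.
apply: sumr_le0 => z Zz; apply: fan_term_le0.
by rewrite (disjointFr coreN) // (subsetP sZN).
Qed.

Lemma deg_cond_meet_core J t x y :
    let H := core G t in let K := meet J H in
    (x, y) \in arcs K -> cdeg_cond H K x y t ->
  deg_cond J x y (Delta (whole G) + t).
Proof.
move=> H K Kxy /forallP cdegP.
have /andP[Hx Hy] : (x \in verts H) && (y \in verts H).
  move: Kxy; rewrite !inE card_gt0 => /set0Pn[e].
  rewrite inE => /andP[/setIP[_ He] /eqP De].
  have := forall_inP (valP H) e He.
  by rewrite De subUset !sub1set !inE.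
apply/orP; right; apply/forallP => Z; apply/implyP => /and3P[sZN Zy _].
(* [Z'] may shrink to the singleton of [y]; [cdeg_cond] still applies, as it puts no lower bound on
   the size of the set. *)
pose Z' := Z :&: verts H.
have Z'P : (Z' \subset nbr K x) && (y \in Z').
  apply/andP; split; [apply/subsetP => z /setIP[Zz Hz] | exact/setIP].
  by rewrite inE mu_meet_induced //; have := subsetP sZN z Zz; rewrite inE.
apply: le_trans (implyP (cdegP Z') Z'P).
rewrite (big_setID (verts H)) /= -[leRHS]addr0; apply: lerD.
  apply: ler_sum => z /setIP[_ Hz]; rewrite mu_meet_induced //.
  have := degree_meet J H z; have := degree_Delta z; rewrite -/K -/H; lia.
by apply: sumr_le0 => z /setDP[_ Hz]; apply: fan_term_le0.
Qed.

(** As the meet is edgeless, no two vertices of [S] are adjacent in [J], so every arc of [J]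
    starting in [S] qualifies. *)
Lemma core_free_arc J S :
    edges J != set0 -> edges (meet J (induced S)) = set0 ->
  exists2 p, p \in arcs J & [disjoint nbr J p.1 & S].
Proof.
move=> J0 K0.
have coreN x : x \in S -> [disjoint nbr J x & S].
  move=> Sx; rewrite disjoints_subset; apply/subsetP => z.
  rewrite !inE => Jxz; apply: contraL Jxz => Sz.
  rewrite -(mu_meet_induced J Sx Sz) -leqNgt leqn0 /mu K0 cards_eq0.
  by apply/eqP/setP => e; rewrite !inE.
have /set0Pn[[x y] Jxy] := arcs_neq0 J0.
have [coreNx|] := boolP [disjoint nbr J x & S]; first by exists (x, y).
(* If [x] has a neighbour [z] in [S], the arc from [z] back to [x] starts in [S]. *)
rewrite -setI_eq0 => /set0Pn[z /setIP[Jxz Sz]].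
by exists (z, x); [rewrite arcsC inE | apply: coreN].
Qed.

End Subgraphs.

Theorem theorem1p7 (G : mgraph) (t : nat) :
  cfan (core G t) <= t -> Fan (whole G) <= Delta (whole G) + t.
Proof.
move=> cfan_t; rewrite /Fan geq_max leq_addr; apply: fan_leq => J _ J0.
have [K0 | K0] := eqVneq (edges (meet J (core G t))) set0.
  have [p Jp coreN] := core_free_arc J0 K0.
  by exists p => //; apply: deg_cond_core_free.
have [[x y] Kxy xyP] := cfan_leq cfan_t (meet_subr J (core G t)) K0.
exists (x, y); last exact: deg_cond_meet_core Kxy xyP.
by move: Kxy; rewrite !inE => /leq_trans; apply; apply/mu_sub/subsetIl.
Qed.
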